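(* Let $k$ be a field, $n\in\mathbb{N}\setminus\{0\}$, and let $s=\sum_{g\in\mathbb{Z}^n}s_g\underline{x}^g\in k((\underline{x}))$. Set $h_0=0\in\mathbb{Z}^n$ and let $r_0\in k\setminus\{0\}$. Suppose that there exist $\ell\in\mathbb{N}$, a set $A=\{h_0,\ldots,h_\ell\}\subseteq\mathbb{N}^n$ with $h_0<_{\mathrm{lex}}\ldots<_{\mathrm{lex}}h_\ell$, and elements $r_1,\ldots,r_\ell\in k$ such that for any $g\in\mathbb{Z}^n\setminus A$ $$\sum_{j=0}^\ell r_js_{g-h_j}=0.$$ Then $s\in k(\underline{x})\cap k[[\underline{x}]]$.
   Context: $\mathbb{N}$ includes $0$. $\mathbb{Z}^n$ is an ordered abelian group under the lexicographic ordering $<_{\mathrm{lex}}$. $k((\mathbb{Z}^n))$ is the field of generalised power series: all functions $s\colon\mathbb{Z}^n\to k$, written $s=\sum_{g}s_gt^g$, with well-ordered (for $<_{\mathrm{lex}}$) support $\{g\mid s_g\neq 0\}$, with pointwise addition and convolution product $sp=\sum_{g}\left(\sum_{h}s_hp_{g-h}\right)t^g$. Write $\underline{x}=(x_1,\ldots,x_n)$ and $\underline{x}^g=x_1^{g_1}\cdots x_n^{g_n}$. $k(\underline{x})$ is the fraction field of $k[\underline{x}]$ and $k((\underline{x}))$ is the fraction field of the formal power series ring $k[[\underline{x}]]$. Since $\mathbb{N}^n$ is well-ordered by $<_{\mathrm{lex}}$, the map $\sum_{g\in\mathbb{N}^n}s_g\underline{x}^g\mapsto\sum_{g\in\mathbb{N}^n}s_gt^g$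 embeds $k[[\underline{x}]]$ in $k((\mathbb{Z}^n))$; this extends to an embedding of $k((\underline{x}))$ in $k((\mathbb{Z}^n))$, and via it each element of $k((\underline{x}))$ is expanded uniquely as $\sum_{g\in\mathbb{Z}^n}s_g\underline{x}^g$, where $\sum_{g}s_gt^g$ is its image in $k((\mathbb{Z}^n))$. *)

(* Defs.v *)
From HB Require Import structures.
From mathcomp Require Import all_boot all_order all_algebra.
From mathcomp Require Import boolp classical_sets functions cardinality fsbigop.
From mathcomp Require Import mpoly.

Set Implicit Arguments.
Unset Strict Implicit.
Unset Printing Implicit Defensive.

Import Order.TTheory GRing.Theory Num.Theory.
Local Open Scope ring_scope.
Local Open Scope classical_set_scope.

(* The ordered abelian group Z^n; the order is pulled back from the library's
   lexicographic order on tuples. *)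
Definition Zlex (n : nat) := {ffun 'I_n -> int}.

HB.instance Definition _ n := GRing.Zmodule.on (Zlex n).

Fact lex_display : Order.disp_t. Proof. exact: Order.Disp tt tt. Qed.

Section LexOrder.
Variable n : nat.
Implicit Types x y z : Zlex n.

Definition lex_tuple x : n.-tuplelexi int := [tuple x i | i < n].
Definition tuple_lex (t : n.-tuplelexi int) : Zlex n := [ffun i => tnth t i].

Lemma lex_tupleK : cancel lex_tuple tuple_lex.
Proof. by move=> x; apply/ffunP => i; rewrite ffunE tnth_mktuple. Qed.

HB.instance Definition _ : Order.isPOrder lex_display (Zlex n) :=
  @Order.CanIsPartial lex_display (Zlex n)
    _ (n.-tuplelexi int) lex_tuple tuple_lex lex_tupleK.

Lemma lex_le_total : total (<=%O : rel (Zlex n)).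
Proof. by move=> x y; exact: (le_total (lex_tuple x) (lex_tuple y)). Qed.

HB.instance Definition _ :=
  Order.POrder_isTotal.Build lex_display (Zlex n) lex_le_total.

Lemma lex_ltP x y : reflect
  (exists2 i : 'I_n, forall j : 'I_n, (j < i)%N -> x j = y j & x i < y i)
  (x < y)%O.
Proof.
apply: (iffP (Order.TupleLexiOrder.ltxi_tuplePlt
  (lex_tuple x : n.-tuplelexi int) (lex_tuple y))).
- move=> [i e l]; exists i; last by move: l; rewrite !tnth_mktuple.
  by move=> j /e; rewrite !tnth_mktuple.
- move=> [i e l]; exists i; last by rewrite !tnth_mktuple.
  by move=> j /e; rewrite !tnth_mktuple.
Qed.

Lemma lex_ltD2r z x y : (x + z < y + z)%O = (x < y)%O.
Proof.
apply/lex_ltP/lex_ltP => -[i e l]; exists i.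
- by move=> j /e; rewrite !ffunE => /addIr.
- by move: l; rewrite !ffunE ltrD2r.
- by move=> j /e; rewrite !ffunE => ->.
- by rewrite !ffunE ltrD2r.
Qed.

Lemma lex_leD2r z x y : (x + z <= y + z)%O = (x <= y)%O.
Proof. by rewrite !leNgt lex_ltD2r. Qed.

Lemma lex_leB2l z x y : (z - x <= z - y)%O = (y <= x)%O.
Proof.
rewrite -(lex_leD2r (x + y - z)); congr (_ <= _)%O.
  by rewrite addrC -addrA addKr addrAC subrr add0r.
by rewrite addrC -addrA addKr addrK.
Qed.

End LexOrder.

Section WellOrdered.
Variable n : nat.
Local Notation G := (Zlex n).
Implicit Types A B : set G.

Definition well_ordered A :=
  forall T : set G, T `<=` A -> T !=set0 ->
    exists2 m, T m & forall x, T x -> (m <= x)%O.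

Lemma well_orderedS A B : A `<=` B -> well_ordered B -> well_ordered A.
Proof. by move=> AB wB T TA; apply: wB => x /TA /AB. Qed.

Lemma well_ordered0 : well_ordered set0.
Proof. by move=> T T0 [x /T0]. Qed.

Lemma well_ordered1 g : well_ordered [set g].
Proof.
move=> T Tg [x Tx]; exists x => // y /Tg ->.
by rewrite (Tg _ Tx).
Qed.

Lemma well_orderedU A B :
  well_ordered A -> well_ordered B -> well_ordered (A `|` B).
Proof.
move=> wA wB T TAB T0.
have [[a [Ta Aa]]|nA] := pselect ((T `&` A) !=set0); last first.
  apply: wB => // x Tx; case: (TAB x Tx) => // Ax.
  by case: nA; exists x.
have [[b [Tb Bb]]|nB] := pselect ((T `&` B) !=set0); last first.
  apply: wA => // x Tx; case: (TAB x Tx) => // Bx.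
  by case: nB; exists x.
have [|m [Tm Am] mP] := wA (T `&` A) (@subIsetr _ _ _); first by exists a.
have [|p [Tp Bp] pP] := wB (T `&` B) (@subIsetr _ _ _); first by exists b.
case: (leP m p) => mp.
  exists m => // x Tx; case: (TAB x Tx) => ?; first by apply: mP.
  by apply: le_trans mp _; apply: pP.
exists p => // x Tx; case: (TAB x Tx) => ?; last by apply: pP.
by apply: le_trans (ltW mp) _; apply: mP.
Qed.

Lemma well_orderedD A B : well_ordered A -> well_ordered B ->
  well_ordered [set g | exists2 a, A a & B (g - a)].
Proof.
move=> wA wB S SAB S0.
pose P a b := [/\ A a, B b & S (a + b)].
have PS g : S g -> exists a b, P a b /\ g = a + b.
  move=> Sg; have [a Aa Bb] := SAB g Sg; exists a, (g - a).
  by split; [split=> //|]; rewrite addrC subrK.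
pose R a b := P a b /\
  forall a' b', P a' b' -> (a' < a)%O -> (a + b <= a' + b')%O.
have exA (Q : set G) : (exists2 a, A a & Q a) ->
    exists2 a, A a & Q a /\ forall a', A a' -> Q a' -> (a <= a')%O.
  move=> [a0 Aa0 Qa0].
  have [|a [Aa Qa] aP] := wA (A `&` Q) (@subIsetl _ _ _); first by exists a0.
  by exists a => //; split=> // a' *; apply: aP.
have [||b [a [[Aa Bb Sab] Rab]] bP] := wB [set b | exists a, R a b].
- by move=> b [a [[]]].
- case: S0 => g /PS [a0 [b0 [P0 _]]].
  have [|a Aa [[b Pab] aP]] := exA [set a | exists b, P a b].
    by exists a0; [case: P0|exists b0].
  exists b, a; split=> // a' b' P'; rewrite ltNge aP //; first by case: P'.
  by exists b'.
exists (a + b) => // g /PS [a1 [b1 [P1 ->]]]; rewrite leNgt; apply/negP => lt1.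
have [|a2 Aa2 [[b2 P2 lt2] aP]] :=
    exA [set a' | exists2 b', P a' b' & (a' + b' < a + b)%O].
  by exists a1; [case: P1|exists b1].
have le_a : (a <= a2)%O.
  by rewrite leNgt; apply/negP => /(Rab _ _ P2); rewrite leNgt lt2.
have lt_b : (b2 < b)%O.
  rewrite -(lex_ltD2r a) ![_ + a]addrC; apply: le_lt_trans lt2.
  by rewrite lex_leD2r.
have : (b <= b2)%O; last by rewrite leNgt lt_b.
apply: bP; exists a2; split=> // a' b' P' lt'.
rewrite leNgt; apply/negP => lt''.
have : (a2 <= a')%O; last by rewrite leNgt lt'.
apply: aP; first by case: P'.
by exists b' => //; apply: lt_trans lt'' lt2.
Qed.

Lemma well_ordered_dual_finite A :
  well_ordered A ->
  (forall T : set G, T `<=` A -> T !=set0 ->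
    exists2 m, T m & forall x, T x -> (x <= m)%O) ->
  exists2 r : seq G, uniq r & forall x, A x -> x \in r.
Proof.
move=> wA dA; suff [r rP] : exists r : seq G, forall x, A x -> x \in r.
  by exists (undup r); [exact: undup_uniq|move=> x /rP; rewrite mem_undup].
pose Q x := exists r : seq G, forall y, A y -> (y <= x)%O -> y \in r.
have AQ x : A x -> Q x.
  move=> Ax; apply: contrapT => nQ.
  have [|m [Am nQm] mP] := wA (A `&` [set x | ~ Q x]) (@subIsetl _ _ _).
    by exists x.
  apply: nQm.
  have [T0|T0] := pselect ((A `&` [set y | (y < m)%O]) !=set0); last first.
    exists [:: m] => y Ay; rewrite le_eqVlt inE => /orP[//|ym].
    by case: T0; exists y.
  have [p [Ap /= pm] pP] := dA _ (@subIsetl _ _ _) T0.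
  have [r rP] : Q p.
    apply: contrapT => nQp; have : (m <= p)%O by apply: mP.
    by rewrite leNgt pm.
  exists (m :: r) => y Ay; rewrite le_eqVlt inE => /orP[->//|ym].
  by rewrite rP ?orbT //; apply: pP.
have [A0|A0] := pselect (A !=set0); last first.
  by exists [::] => x Ax; case: A0; exists x.
have [m Am mP] := dA A (@subset_refl _ _) A0.
by have [r rP] := AQ _ Am; exists r => x Ax; apply: rP => //; apply: mP.
Qed.

Lemma well_ordered_fiber A B g : well_ordered A -> well_ordered B ->
  exists2 r : seq G, uniq r & forall h, A h -> B (g - h) -> h \in r.
Proof.
move=> wA wB.
have [||r ur rP] := @well_ordered_dual_finite [set h | A h /\ B (g - h)].
- by apply: well_orderedS wA => x [].
- move=> T TA [x Tx].
  have [||m Tm mP] := wB [set b | T (g - b)].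
  + by move=> b /TA [_]; rewrite opprB addrC subrK.
  + by exists (g - x) => /=; rewrite opprB addrC subrK.
  exists (g - m) => // y Ty; rewrite -(subKr g y) lex_leB2l; apply: mP => /=.
  by rewrite subKr.
by exists r => // h Ah Bh; apply: rP.
Qed.

End WellOrdered.

(* k((Z^n)) *)
Record hahn (k : fieldType) (n : nat) := Hahn {
  hcoef :> Zlex n -> k;
  _ : `[< well_ordered [set g | hcoef g != 0] >] }.

HB.instance Definition _ k n := [isSub for @hcoef k n].
HB.instance Definition _ k n := [Choice of hahn k n by <:].

Section HahnRing.
Variables (k : fieldType) (n : nat).
Local Notation G := (Zlex n).
Local Notation H := (hahn k n).
Implicit Types s p q : H.

Definition hsupp (s : G -> k) : set G := [set g | s g != 0].

Lemma hahnP s p : (forall g, s g = p g) <-> s = p.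
Proof. by split=> [sp|-> //]; apply: val_inj; apply: funext. Qed.

Lemma hahn_wo s : well_ordered (hsupp s).
Proof. by case: s => s ?; apply/asboolP. Qed.
Arguments hahn_wo : clear implicits.

Lemma hahn0_subproof : `[< well_ordered (hsupp (fun=> 0)) >].
Proof.
apply/asboolP; apply: (@well_orderedS _ _ set0); last exact: well_ordered0.
by move=> x; rewrite /hsupp /= eqxx.
Qed.
Definition hahn0 : H := Hahn hahn0_subproof.

Lemma hahn_mon_subproof (c : k) (g : G) :
  `[< well_ordered (hsupp (fun h => if h == g then c else 0)) >].
Proof.
apply/asboolP; apply: (well_orderedS _ (@well_ordered1 n g)) => x.
by rewrite /hsupp /=; case: (x =P g) => // _; rewrite eqxx.
Qed.
(* the monomial c t^g *)
Definition hahn_mon c g : H := Hahn (hahn_mon_subproof c g).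

Lemma hahn_opp_subproof s : `[< well_ordered (hsupp (fun g => - s g)) >].
Proof.
apply/asboolP; apply: (well_orderedS _ (hahn_wo s)) => x.
by rewrite /hsupp /= oppr_eq0.
Qed.
Definition hahn_opp s : H := Hahn (hahn_opp_subproof s).

Lemma hahn_add_subproof s p : `[< well_ordered (hsupp (fun g => s g + p g)) >].
Proof.
apply/asboolP; apply: (well_orderedS _ (well_orderedU (hahn_wo s) (hahn_wo p))) => x.
rewrite /hsupp /=; have [->|?] := eqVneq (s x) 0; last by left.
by rewrite add0r; right.
Qed.
Definition hahn_add s p : H := Hahn (hahn_add_subproof s p).

(* [\sum_(h \in A)] sums over the indices with nonzero term, of which
   there are finitely many here by [well_ordered_fiber]. *)
Definition hconv (s p : G -> k) (g : G) : k :=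
  \sum_(h \in [set: G]) s h * p (g - h).

Lemma hconvE (r : seq G) (s p : G -> k) g : uniq r ->
  (forall h, s h != 0 -> p (g - h) != 0 -> h \in r) ->
  hconv s p g = \sum_(h <- r) s h * p (g - h).
Proof.
move=> ur rP; rewrite /hconv (fsbigE r) //.
  by apply: eq_bigl => h; rewrite in_setT.
move=> h _ hr; apply/eqP.
by apply: contraNT hr; rewrite mulf_eq0 negb_or => /andP[]; apply: rP.
Qed.

Lemma hconv_neq0 (s p : G -> k) g : hconv s p g != 0 ->
  exists2 h, s h != 0 & p (g - h) != 0.
Proof.
move=> nz; apply: contrapT => nex; move/eqP: nz; apply.
rewrite (@hconvE [::]) ?big_nil // => h sh ph.
by case: nex; exists h.
Qed.

Lemma hahn_mul_subproof s p : `[< well_ordered (hsupp (hconv s p)) >].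
Proof.
apply/asboolP; apply: (well_orderedS _ (well_orderedD (hahn_wo s) (hahn_wo p))) => g.
by rewrite /hsupp /= => /hconv_neq0.
Qed.
Definition hahn_mul s p : H := Hahn (hahn_mul_subproof s p).

Lemma hahn_addA : associative hahn_add.
Proof. by move=> s p q; apply/hahnP => g /=; rewrite addrA. Qed.
Lemma hahn_addC : commutative hahn_add.
Proof. by move=> s p; apply/hahnP => g /=; rewrite addrC. Qed.
Lemma hahn_add0 : left_id hahn0 hahn_add.
Proof. by move=> s; apply/hahnP => g /=; rewrite add0r. Qed.
Lemma hahn_addN : left_inverse hahn0 hahn_opp hahn_add.
Proof. by move=> s; apply/hahnP => g /=; rewrite addNr. Qed.

HB.instance Definition _ :=
  GRing.isZmodule.Build H hahn_addA hahn_addC hahn_add0 hahn_addN.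

Lemma hconvC (s p : G -> k) : hconv s p =1 hconv p s.
Proof.
move=> g; rewrite /hconv (@reindex_fsbigT _ _ _ _ _ (fun h : G => g - h)).
  by apply: eq_fsbigr => h _; rewrite subKr mulrC.
by exists (fun h : G => g - h) => h; rewrite subKr.
Qed.

Lemma hahn_mulC : commutative hahn_mul.
Proof. by move=> s p; apply/hahnP => g; apply: hconvC. Qed.

Lemma hahn_mulA : associative hahn_mul.
Proof.
move=> s p q; apply/hahnP => g /=.
have [r1 u1 r1P] := well_ordered_fiber g (hahn_wo s)
  (well_orderedD (hahn_wo p) (hahn_wo q)).
have [r2 u2 r2P] := well_ordered_fiber g
  (well_orderedD (hahn_wo s) (hahn_wo p)) (hahn_wo q).
rewrite (hconvE u1); last first.
  by move=> h sh /hconv_neq0 ?; apply: r1P.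
rewrite [RHS](hconvE u2); last first.
  by move=> h /hconv_neq0 ? qh; apply: r2P.
transitivity (\sum_(h <- r1) \sum_(a <- r2) s h * (p (a - h) * q (g - a))).
  apply: eq_bigr => h _; have [->|sh] := eqVneq (s h) 0.
    by rewrite mul0r big1 // => a _; rewrite mul0r.
  rewrite -mulr_sumr; congr (_ * _) => /=.
  rewrite (@hconvE [seq a - h | a <- r2]) ?big_map.
  - by apply: eq_bigr => a _; congr (_ * q _); rewrite opprB addrA subrK.
  - by rewrite map_inj_uniq //; apply: addIr.
  - move=> e pe qe; apply/mapP; exists (e + h); last by rewrite addrK.
    apply: r2P; first by exists h => //; rewrite /hsupp /= addrK.
    by rewrite /hsupp /= opprD addrA addrAC.
rewrite exchange_big; apply: eq_bigr => a _ /=.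
have [->|qa] := eqVneq (q (g - a)) 0.
  by rewrite mulr0 big1 // => h _; rewrite !mulr0.
rewrite (hconvE u1) ?mulr_suml; first by apply: eq_bigr => h _; rewrite mulrA.
move=> h sh ph; apply: r1P => //; exists (a - h) => //.
by rewrite /hsupp /= opprB addrA subrK.
Qed.

Definition hahn1 : H := hahn_mon 1 0.

Lemma hahn_mon_mul c g s (h : G) : hahn_mul (hahn_mon c g) s h = c * s (h - g).
Proof.
rewrite /= (@hconvE [:: g]) //=.
  by rewrite big_seq1 /= eqxx.
by move=> x; rewrite inE; case: (x =P g) => //; rewrite eqxx.
Qed.

Lemma hahn_mul1 : left_id hahn1 hahn_mul.
Proof. by move=> s; apply/hahnP => g; rewrite hahn_mon_mul mul1r subr0. Qed.

Lemma hahn_mulDl : left_distributive hahn_mul hahn_add.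
Proof.
move=> s p q; apply/hahnP => g /=.
have [r1 u1 r1P] := well_ordered_fiber g
  (well_orderedU (hahn_wo s) (hahn_wo p)) (hahn_wo q).
rewrite !(hconvE u1).
- by rewrite -big_split; apply: eq_bigr => h _; rewrite mulrDl.
- by move=> h ? ?; apply: r1P => //; right.
- by move=> h ? ?; apply: r1P => //; left.
- move=> h /= nz ?; apply: r1P => //.
  rewrite /hsupp /=; have [s0|?] := eqVneq (s h) 0; last by left.
  by right; move: nz; rewrite s0 add0r.
Qed.

Lemma hahn_1neq0 : hahn1 != hahn0.
Proof.
apply/eqP => /hahnP /(_ 0) /=; rewrite eqxx => /eqP.
by rewrite oner_eq0.
Qed.

HB.instance Definition _ := GRing.Zmodule_isComNzRing.Build H
  hahn_mulA hahn_mulC hahn_mul1 hahn_mulDl hahn_1neq0.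


Lemma hahn0E g : (0 : H) g = 0. Proof. by []. Qed.
Lemma hahnDE s p g : (s + p) g = s g + p g. Proof. by []. Qed.
Lemma hahnNE s g : (- s) g = - s g. Proof. by []. Qed.
Lemma hahn1E g : (1 : H) g = (g == 0)%:R.
Proof. by rewrite /= ; case: (g == 0). Qed.
Lemma hahnME s p g : (s * p) g = hconv s p g. Proof. by []. Qed.
Lemma hahn_monE c g s h : (hahn_mon c g * s) h = c * s (h - g).
Proof. exact: hahn_mon_mul. Qed.

Lemma hahn_min s : s != 0 ->
  exists2 m, s m != 0 & forall h : G, (h < m)%O -> s h = 0.
Proof.
move=> s0; have [||m sm mP] := hahn_wo s (hsupp s).
- by [].
- apply: contrapT => nex; move/eqP: s0; apply; apply/hahnP => g.
  by apply/eqP; apply: contrapT => /negP sg; apply: nex; exists g.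
exists m => // h hm; apply/eqP; apply: contrapT => /negP /mP.
by rewrite leNgt hm.
Qed.

(* Inversion of a series [s = 1 + (terms of positive exponent)]: the inverse
   is the union of the series [y] such that [s * y] and [1] agree up to every
   exponent of the support of [y]. *)
Section Normalised.
Implicit Types (y z d : H) (g h : G).
Variable s : H.
Hypotheses (s0 : s 0 = 1) (s_ge0 : forall h : G, (h < 0 :> G)%O -> s h = 0).

Lemma hahn_mul_local y z g : (forall h, (h <= g)%O -> y h = z h) ->
  (s * y) g = (s * z) g.
Proof.
move=> yz; apply: eq_fsbigr => h _; have [h0|h0] := ltP h (0 : G).
  by rewrite s_ge0 // !mul0r.
by rewrite yz // -{2}[g]subr0 lex_leB2l.
Qed.

Lemma hahn_mul_lead d g : (forall h, (h < g)%O -> d h = 0) -> (s * d) g = d g.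
Proof.
move=> dP; rewrite hahnME (@hconvE [:: 0]) // ?big_seq1 ?subr0 ?s0 ?mul1r //.
move=> h sh dh; rewrite inE eq_le !leNgt; apply/andP; split; apply/negP => h0.
  by rewrite dP ?eqxx // in dh; rewrite ltNge -{1}[g]subr0 lex_leB2l -ltNge.
by rewrite s_ge0 ?eqxx in sh.
Qed.

Definition approx (y : H) :=
  forall g, y g != 0 -> forall h, (h <= g)%O -> (s * y) h = (1 : H) h.

Lemma approx_agree y z g g' : approx y -> approx z ->
  y g != 0 -> z g' != 0 -> (g' <= g)%O -> forall h, (h <= g')%O -> y h = z h.
Proof.
move=> ay az yg zg' le_g h hg'; apply/eqP; apply: contrapT => /negP yzh.
have wU := well_orderedU (hahn_wo y) (hahn_wo z).
have [||m [mg' yzm] mP] := wU [set h : G | (h <= g')%O /\ y h != z h].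
- move=> x [_]; rewrite /hsupp /=; have [->|?] := eqVneq (y x) 0; last by left.
  by rewrite eq_sym; right.
- by exists h.
have : (s * (y - z)) m = (y - z) m.
  apply: hahn_mul_lead => x xm; rewrite hahnDE hahnNE; apply/eqP.
  rewrite subr_eq0; apply: contrapT => /negP yzx.
  have : (m <= x)%O; last by rewrite leNgt xm.
  by apply: mP; split=> //; apply: le_trans (ltW xm) mg'.
rewrite mulrBr !hahnDE !hahnNE (ay g) ?(az g') //; last exact: le_trans le_g.
by rewrite subrr => /esym/eqP; rewrite subr_eq0 (negPf yzm).
Qed.

Definition approx_lim_fun (g : G) : k :=
  xget (0 : H) [set y | approx y /\ y g != 0] g.

Lemma approx_lim_neq0 g : approx_lim_fun g != 0 ->
  exists2 y, approx y & y g != 0.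
Proof.
rewrite /approx_lim_fun; case: xgetP => [y _ [ay yg] _|_]; last first.
  by rewrite hahn0E eqxx.
by exists y.
Qed.

Lemma approx_limE y g h : approx y -> y g != 0 -> (h <= g)%O ->
  approx_lim_fun h = y h.
Proof.
move=> ay yg hg; rewrite /approx_lim_fun; case: xgetP => [z _ [az zh]|nex].
  by apply/esym; apply: (approx_agree ay az yg zh).
apply/esym/eqP; apply: contrapT => /negP yh.
by case: (nex y).
Qed.

Lemma approx_lim_subproof : `[< well_ordered (hsupp approx_lim_fun) >].
Proof.
apply/asboolP => T TS [x Tx]; have [y ay yx] := approx_lim_neq0 (TS _ Tx).
have [||m [Tm mx] mP] := hahn_wo y (T `&` [set t | (t <= x)%O]).
- move=> t [Tt tx]; rewrite /hsupp /= -(approx_limE ay yx tx).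
  exact: TS.
- by exists x; split=> /=.
exists m => // t Tt; have [tx|xt] := leP t x; first by apply: mP.
exact: le_trans mx (ltW xt).
Qed.
Definition approx_lim : H := Hahn approx_lim_subproof.

Lemma approx_lim_approx : approx approx_lim.
Proof.
move=> g /approx_lim_neq0 [y ay yg] h hg; rewrite -(ay g yg h hg).
apply: hahn_mul_local => x xh; apply: (approx_limE ay yg).
exact: le_trans hg.
Qed.

Lemma hahn_norm_inv : s * approx_lim = 1.
Proof.
set y := approx_lim; apply/eqP; rewrite eq_sym -subr_eq0.
apply: contrapT => /negP /hahn_min [g]; set c := (1 - s * y) g => c0 gP.
have y_lt e : y e != 0 -> (e < g)%O.
  move=> ye; rewrite ltNge; apply/negP => ge; move/eqP: c0; apply.
  by rewrite /c hahnDE hahnNE (approx_lim_approx ye ge) subrr.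
have yg : y g = 0.
  by apply/eqP; apply: contrapT => /negP /y_lt; rewrite ltxx.
pose y' := y + hahn_mon c g.
have y'g : y' g = c by rewrite hahnDE yg add0r /= eqxx.
have y'E h : (s * y') h = (s * y) h + c * s (h - g).
  by rewrite mulrDr hahnDE [s * hahn_mon _ _]mulrC hahn_monE.
have y'lt h : (h < g)%O -> (s * y') h = (1 : H) h.
  move=> hg; rewrite y'E s_ge0; last by rewrite -(lex_ltD2r g) subrK add0r.
  rewrite mulr0 addr0; apply/esym/eqP; rewrite -subr_eq0; apply/eqP.
  exact: gP.
have ay' : approx y'.
  move=> e y'e h he; have [eg|ge] := ltP e g.
    exact: y'lt (le_lt_trans he eg).
  have eg : e = g.
    apply/eqP; apply: contrapT => /negP /negPf neg; move: y'e.
    have -> : y' e = y e by rewrite hahnDE /= neg addr0.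
    by move/y_lt; rewrite ltNge ge.
  move: he; rewrite eg le_eqVlt => /orP[/eqP ->|]; last exact: y'lt.
  by rewrite y'E subrr s0 mulr1 /c hahnDE hahnNE addrC subrK.
have : y g = y' g by apply: (approx_limE ay' _ (lexx g)); rewrite y'g.
by rewrite yg y'g => /esym/eqP; rewrite (negPf c0).
Qed.

End Normalised.

Lemma hahn_inv_ex s : s != 0 -> exists y, y * s = 1.
Proof.
move=> /hahn_min [m sm mP]; pose u := hahn_mon (s m)^-1 (- m).
have u0 : (u * s) 0 = 1 by rewrite hahn_monE opprK add0r mulVf.
have u_ge0 h : (h < 0 :> G)%O -> (u * s) h = 0.
  move=> h0; rewrite hahn_monE opprK (mP (h + m)) ?mulr0 //.
  by move: h0; rewrite -(lex_ltD2r m) add0r.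
exists (approx_lim u0 u_ge0 * u).
by rewrite -mulrA mulrC hahn_norm_inv.
Qed.

Definition hahn_inv s : H := xget 0 [set y | y * s = 1].

Lemma hahn_mulV s : s != 0 -> hahn_inv s * s = 1.
Proof.
move=> /hahn_inv_ex [y ys].
by apply: (@xgetPex _ 0 [set y | y * s = 1]); exists y.
Qed.

Lemma hahn_inv0 : hahn_inv 0 = 0.
Proof.
rewrite /hahn_inv; case: xgetP => // y _ /=.
by rewrite mulr0 => /esym/eqP; rewrite oner_eq0.
Qed.

HB.instance Definition _ := GRing.ComNzRing_isField.Build H hahn_mulV hahn_inv0.

End HahnRing.

(* k[[x_1, ..., x_n]] *)
Record pseries (k : fieldType) (n : nat) := PSeries {
  pcoef :> 'X_{1..n} -> k }.

HB.instance Definition _ k n := [isNew for @pcoef k n].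
HB.instance Definition _ k n := [Choice of pseries k n by <:].

Section NatExponents.
Variable n : nat.
Implicit Types (m u : 'X_{1..n}) (g h : Zlex n).

Definition mnm_lex m : Zlex n := [ffun i => (m i)%:Z].
Definition lex_mnm g : 'X_{1..n} := [multinom `|g i|%N | i < n].
Definition lex_nonneg g := [forall i, 0 <= g i].

Lemma mnm_lexK : cancel mnm_lex lex_mnm.
Proof. by move=> m; apply/mnmP => i; rewrite mnmE ffunE absz_nat. Qed.

Lemma lex_mnmK g : lex_nonneg g -> mnm_lex (lex_mnm g) = g.
Proof. by move/forallP => g0; apply/ffunP => i; rewrite ffunE mnmE gez0_abs. Qed.

Lemma mnm_lex_nonneg m : lex_nonneg (mnm_lex m).
Proof. by apply/forallP => i; rewrite ffunE. Qed.

Lemma lex_nonnegD g h : lex_nonneg g -> lex_nonneg h -> lex_nonneg (g + h).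
Proof.
by move=> /forallP g0 /forallP h0; apply/forallP => i; rewrite ffunE addr_ge0.
Qed.

Lemma mnm_lexB m u : (u <= m)%MM -> mnm_lex m - mnm_lex u = mnm_lex (m - u)%MM.
Proof.
move=> /mnm_lepP um; apply/ffunP => i; rewrite !ffunE mnmBE.
by rewrite subzn.
Qed.

Lemma mnm_lexB_nonneg m u : lex_nonneg (mnm_lex m - mnm_lex u) -> (u <= m)%MM.
Proof.
move=> /forallP um; apply/mnm_lepP => i.
by have := um i; rewrite !ffunE subr_ge0.
Qed.

Lemma lex_nonneg_wo : well_ordered [set g | lex_nonneg g].
Proof.
move=> T TN T0; pose agree i g h := forall j : 'I_n, (j < i)%N -> g j = h j.
pose Q i g := T g /\ forall h, T h -> agree i g h \/
  exists j : 'I_n, [/\ (j < i)%N, agree j g h & g j < h j].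
suff [g [Tg gP]] : exists g, Q n g.
  exists g => // h /gP [gh|[j [_ gh lt]]].
    by rewrite le_eqVlt; apply/orP; left; apply/eqP/ffunP => j; apply: gh.
  by apply: ltW; apply/lex_ltP; exists j.
suff H i : (i <= n)%N -> exists g, Q i g by exact: H.
elim: i => [_|i IH lt_in].
  by have [g Tg] := T0; exists g; split=> // h _; left.
have [g [Tg gP]] := IH (ltnW lt_in); pose io := Ordinal lt_in.
pose V v := `[< exists h, [/\ T h, agree i g h & h io = v%:Z] >].
have exV : exists v, V v.
  exists `|g io|%N; apply/asboolP; exists g; split=> //.
  by rewrite gez0_abs //; move/TN: Tg => /forallP.
case: (ex_minnP exV) => v /asboolP [g' [Tg' gg' g'v]] vmin.
exists g'; split=> // h Th; case: (gP h Th) => [gh|[j [ji gh lt_j]]]; last first.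
  right; exists j; split; [exact: ltnW| |by rewrite -gg'].
  by move=> x xj; rewrite -gg' ?gh // (ltn_trans xj).
have g'h : agree i g' h by move=> x xi; rewrite -gg' ?gh.
have h0 : 0 <= h io by move/TN: Th => /forallP.
have: g' io <= h io.
  rewrite g'v -(gez0_abs h0) lez_nat; apply: vmin; apply/asboolP.
  by exists h; split=> //; rewrite gez0_abs.
rewrite le_eqVlt => /orP[/eqP e|lt]; last by right; exists io.
left=> x; rewrite ltnS leq_eqVlt => /orP[/eqP xi|]; last exact: g'h.
by have -> : x = io by apply: val_inj.
Qed.

End NatExponents.

Section PSeriesRing.
Variables (k : fieldType) (n : nat).
Local Notation P := (pseries k n).
Local Notation H := (hahn k n).
Implicit Types (a b c : P) (m u : 'X_{1..n}).

Lemma pseriesP a b : (forall m, a m = b m) <-> a = b.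
Proof. by split=> [ab|-> //]; apply: val_inj; apply: funext. Qed.

Definition ps0 : P := PSeries (fun=> 0).
Definition ps1 : P := PSeries (fun m => (m == 0%MM)%:R).
Definition ps_opp a : P := PSeries (fun m => - a m).
Definition ps_add a b : P := PSeries (fun m => a m + b m).
Definition ps_mul a b : P := PSeries (fun m =>
  \sum_(u : 'X_{1..n < (mdeg m).+1} | (u <= m)%MM) a u * b (m - u)%MM).

Lemma hahn_of_ps_subproof a : `[< well_ordered (hsupp
  (fun g : Zlex n => if lex_nonneg g then a (lex_mnm g) else 0)) >].
Proof.
apply/asboolP; apply: (well_orderedS _ (@lex_nonneg_wo n)) => g.
by rewrite /hsupp /=; case: ifP => //; rewrite eqxx.
Qed.
(* \sum_g a_g x^g |-> \sum_g a_g t^g *)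
Definition hahn_of_ps a : H := Hahn (hahn_of_ps_subproof a).

Lemma hahn_of_psE a m : hahn_of_ps a (mnm_lex m) = a m.
Proof. by rewrite /= mnm_lex_nonneg mnm_lexK. Qed.

Lemma hahn_of_ps_nonneg a g : hahn_of_ps a g != 0 -> lex_nonneg g.
Proof. by rewrite /=; case: ifP => //; rewrite eqxx. Qed.

Lemma hahn_of_ps_inj : injective hahn_of_ps.
Proof.
by move=> a b ab; apply/pseriesP => m; rewrite -!hahn_of_psE ab.
Qed.

Lemma hahn_ps_ext a (s : H) : (forall m, s (mnm_lex m) = a m) ->
  (forall g, s g != 0 -> lex_nonneg g) -> hahn_of_ps a = s.
Proof.
move=> sa sN; apply/hahnP => g; have [gN|gN] := boolP (lex_nonneg g).
  by rewrite -(lex_mnmK gN) hahn_of_psE sa.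
transitivity (0 : k); first by rewrite /= (negPf gN).
by apply/esym/eqP; apply: contraNT gN; apply: sN.
Qed.

Lemma hahn_of_ps0 : hahn_of_ps ps0 = 0.
Proof. by apply: hahn_ps_ext => // g; rewrite eqxx. Qed.

Lemma hahn_of_psN a : hahn_of_ps (ps_opp a) = - hahn_of_ps a.
Proof.
apply: hahn_ps_ext => [m|g]; rewrite hahnNE ?hahn_of_psE //.
by rewrite oppr_eq0; apply: hahn_of_ps_nonneg.
Qed.

Lemma hahn_of_psD a b :
  hahn_of_ps (ps_add a b) = hahn_of_ps a + hahn_of_ps b.
Proof.
apply: hahn_ps_ext => [m|g]; rewrite hahnDE ?hahn_of_psE //.
have [->|/hahn_of_ps_nonneg //] := eqVneq (hahn_of_ps a g) 0.
by rewrite add0r; apply: hahn_of_ps_nonneg.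
Qed.

Lemma hahn_of_ps1 : hahn_of_ps ps1 = 1.
Proof.
apply: hahn_ps_ext => [m|g]; rewrite hahn1E.
  have m0 : mnm_lex (0%MM : 'X_{1..n}) = 0.
    by apply/ffunP => i; rewrite !ffunE mnm0E.
  by rewrite -m0 (inj_eq (can_inj (@mnm_lexK n))).
have [-> _|] := eqVneq g 0; last by rewrite eqxx.
by apply/forallP => i; rewrite ffunE.
Qed.

Lemma hahn_of_psM a b :
  hahn_of_ps (ps_mul a b) = hahn_of_ps a * hahn_of_ps b.
Proof.
apply: hahn_ps_ext => [m|g]; rewrite hahnME; last first.
  move=> /hconv_neq0 [h /hahn_of_ps_nonneg hN /hahn_of_ps_nonneg ghN].
  by rewrite -(subrK h g); apply: lex_nonnegD.
pose r := [seq u : 'X_{1..n < (mdeg m).+1} <- index_enum _ | (bmnm u <= m)%MM].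
rewrite (@hconvE _ _ [seq mnm_lex (bmnm v) | v : 'X_{1..n < (mdeg m).+1} <- r]).
- rewrite big_map /r big_filter; apply: eq_bigr => u um.
  by rewrite mnm_lexB // !hahn_of_psE.
- rewrite map_inj_uniq; first by rewrite filter_uniq // index_enum_uniq.
  by move=> u v /(can_inj (@mnm_lexK n)) /val_inj.
move=> h /hahn_of_ps_nonneg /lex_mnmK <- /hahn_of_ps_nonneg.
set u := lex_mnm h => /mnm_lexB_nonneg um.
have du : (mdeg u < (mdeg m).+1)%N by rewrite ltnS mdegE mdegE leq_sum // => i _;
  apply/mnm_lepP.
apply/mapP; exists (BMultinom du) => //.
by rewrite mem_filter mem_index_enum um.
Qed.

Local Notation injE := hahn_of_ps_inj.
Let morphE := (hahn_of_psD, hahn_of_psN, hahn_of_ps0, hahn_of_psM, hahn_of_ps1).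

Lemma ps_addA : associative ps_add.
Proof. by move=> a b c; apply: injE; rewrite !morphE addrA. Qed.
Lemma ps_addC : commutative ps_add.
Proof. by move=> a b; apply: injE; rewrite !morphE addrC. Qed.
Lemma ps_add0 : left_id ps0 ps_add.
Proof. by move=> a; apply: injE; rewrite !morphE add0r. Qed.
Lemma ps_addN : left_inverse ps0 ps_opp ps_add.
Proof. by move=> a; apply: injE; rewrite !morphE addNr. Qed.

HB.instance Definition _ := GRing.isZmodule.Build P ps_addA ps_addC ps_add0 ps_addN.

Lemma ps_mulA : associative ps_mul.
Proof. by move=> a b c; apply: injE; rewrite !morphE mulrA. Qed.
Lemma ps_mulC : commutative ps_mul.
Proof. by move=> a b; apply: injE; rewrite !morphE mulrC. Qed.
Lemma ps_mul1 : left_id ps1 ps_mul.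
Proof. by move=> a; apply: injE; rewrite !morphE mul1r. Qed.
Lemma ps_mulDl : left_distributive ps_mul ps_add.
Proof. by move=> a b c; apply: injE; rewrite !morphE mulrDl. Qed.
Lemma ps_1neq0 : ps1 != ps0.
Proof. by apply/eqP => /(congr1 hahn_of_ps); rewrite !morphE; apply/eqP/oner_neq0. Qed.

HB.instance Definition _ := GRing.Zmodule_isComNzRing.Build P
  ps_mulA ps_mulC ps_mul1 ps_mulDl ps_1neq0.

Definition ps_unit : pred P := fun a => `[< exists b, b * a = 1 >].
Definition ps_inv a : P := xget a [set b | b * a = 1].

Lemma ps_mulV : {in ps_unit, left_inverse 1 ps_inv *%R}.
Proof.
by move=> a /asboolP [b ba]; apply: (@xgetPex _ a [set b | b * a = 1]); exists b.
Qed.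
Lemma ps_unitP a b : b * a = 1 -> ps_unit a.
Proof. by move=> ba; apply/asboolP; exists b. Qed.
Lemma ps_inv_out : {in [predC ps_unit], ps_inv =1 id}.
Proof.
move=> a /negP nU; apply: xgetPN => b ba; apply: nU.
exact: (ps_unitP ba).
Qed.

HB.instance Definition _ :=
  GRing.ComNzRing_hasMulInverse.Build P ps_mulV ps_unitP ps_inv_out.

Lemma ps_integral a b : a * b = 0 -> (a == 0) || (b == 0).
Proof.
move=> /(congr1 hahn_of_ps); rewrite hahn_of_psM hahn_of_ps0 => /eqP.
rewrite mulf_eq0 => /orP[] /eqP e; apply/orP; [left|right]; apply/eqP;
  by apply: injE; rewrite e hahn_of_ps0.
Qed.

HB.instance Definition _ := GRing.ComUnitRing_isIntegral.Build P ps_integral.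

Lemma hahn_of_ps_zmod : zmod_morphism hahn_of_ps.
Proof. by move=> a b; rewrite hahn_of_psD hahn_of_psN. Qed.
Lemma hahn_of_ps_monoid : monoid_morphism hahn_of_ps.
Proof. by split; [exact: hahn_of_ps1|exact: hahn_of_psM]. Qed.

HB.instance Definition _ :=
  GRing.isZmodMorphism.Build P H hahn_of_ps hahn_of_ps_zmod.
HB.instance Definition _ :=
  GRing.isMonoidMorphism.Build P H hahn_of_ps hahn_of_ps_monoid.

Definition ps_of_mpoly (p : {mpoly k[n]}) : P := PSeries (fun m => p@_m).

Lemma ps_of_mpoly_inj : injective ps_of_mpoly.
Proof. by move=> p q /pseriesP pq; apply/mpolyP. Qed.

Lemma ps_of_mpoly_zmod : zmod_morphism ps_of_mpoly.
Proof. by move=> p q; apply/pseriesP => m; rewrite /= mcoeffB. Qed.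
Lemma ps_of_mpoly_monoid : monoid_morphism ps_of_mpoly.
Proof.
split=> [|p q]; apply/pseriesP => m /=; first by rewrite mcoeff1.
by rewrite -mcoeff_poly_mul_lin.
Qed.

HB.instance Definition _ :=
  GRing.isZmodMorphism.Build {mpoly k[n]} P ps_of_mpoly ps_of_mpoly_zmod.
HB.instance Definition _ :=
  GRing.isMonoidMorphism.Build {mpoly k[n]} P ps_of_mpoly ps_of_mpoly_monoid.

End PSeriesRing.

(* The extension to the fraction field of an embedding of a domain in a field *)
Local Open Scope quotient_scope.
Local Notation tofrac := (@FracField.tofrac _).

Section FracExt.
Variables (R : idomainType) (F : fieldType) (f : {rmorphism R -> F}).

Definition frac_ext (x : {fraction R}) : F := f \n_(repr x) / f \d_(repr x).

Hypothesis f_inj : injective f.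

Lemma frac_pi (r : {ratio R}) :
  \pi_({fraction R}) r = tofrac \n_r / tofrac \d_r.
Proof.
have d0 : tofrac \d_r != 0 by rewrite tofrac_eq0 denom_ratioP.
apply: (mulIf d0); rewrite divfK //; unlock tofrac.
rewrite -[LHS]FracField.pi_mul; apply/eqmodP; rewrite /= FracField.equivfE.
by rewrite !numden_Ratio ?mulr1 ?oner_neq0 ?denom_ratioP // mulrC.
Qed.

Lemma frac_split (x : {fraction R}) :
  exists n d : R, d != 0 /\ x = tofrac n / tofrac d.
Proof.
exists \n_(repr x), \d_(repr x); split; first exact: denom_ratioP.
by rewrite -frac_pi reprK.
Qed.

Lemma f_neq0 (d : R) : d != 0 -> f d != 0.
Proof. by move=> d0; rewrite -(rmorph0 f) (inj_eq f_inj). Qed.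

Lemma frac_extE (n d : R) : d != 0 -> frac_ext (tofrac n / tofrac d) = f n / f d.
Proof.
move=> d0; set x := _ / _; rewrite /frac_ext; set r := repr x.
have r0 : \d_r != 0 by exact: denom_ratioP.
have : x = tofrac \n_r / tofrac \d_r by rewrite -frac_pi reprK.
move/eqP; rewrite /x eqr_div ?tofrac_eq0 // -!rmorphM tofrac_eq => /eqP e.
by apply/eqP; rewrite eqr_div ?f_neq0 // -!rmorphM e.
Qed.

Lemma frac_ext_tofrac (a : R) : frac_ext (tofrac a) = f a.
Proof.
have := @frac_extE a 1 (oner_neq0 _).
by rewrite !rmorph1 !divr1.
Qed.

Lemma frac_ext_zmod : zmod_morphism frac_ext.
Proof.
move=> x y; have [a [b [b0 ->]]] := frac_split x.
have [c [d [d0 ->]]] := frac_split y.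
rewrite -mulNr -rmorphN addf_div ?tofrac_eq0 // -!rmorphM -rmorphD.
rewrite !frac_extE ?mulf_neq0 // rmorphD !rmorphM rmorphN.
by rewrite -mulNr addf_div ?f_neq0.
Qed.

Lemma frac_ext_monoid : monoid_morphism frac_ext.
Proof.
split=> [|x y]; first by rewrite -(rmorph1 (@FracField.tofrac R)) frac_ext_tofrac rmorph1.
have [a [b [b0 ->]]] := frac_split x; have [c [d [d0 ->]]] := frac_split y.
rewrite mulf_div -!rmorphM !frac_extE ?mulf_neq0 //.
by rewrite !rmorphM mulf_div.
Qed.

End FracExt.

Section Expansion.
Variables (k : fieldType) (n : nat).

(* k((x_1, ..., x_n)) -> k((Z^n)), extending [hahn_of_ps] *)
Definition expand : {fraction (pseries k n)} -> hahn k n :=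
  frac_ext (@hahn_of_ps k n).

HB.instance Definition _ := GRing.isZmodMorphism.Build _ _ expand
  (frac_ext_zmod (@hahn_of_ps_inj k n)).
HB.instance Definition _ := GRing.isMonoidMorphism.Build _ _ expand
  (frac_ext_monoid (@hahn_of_ps_inj k n)).

Lemma expand_tofrac (a : pseries k n) : expand (tofrac a) = hahn_of_ps a.
Proof. exact: (frac_ext_tofrac (@hahn_of_ps_inj k n)). Qed.

(* k(x_1, ..., x_n) -> k((x_1, ..., x_n)) *)
Definition ratfrac_incl : {fraction {mpoly k[n]}} -> {fraction (pseries k n)} :=
  frac_ext (@FracField.tofrac (pseries k n) \o @ps_of_mpoly k n).

Lemma tofrac_ps_of_mpoly_inj :
  injective (@FracField.tofrac (pseries k n) \o @ps_of_mpoly k n).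
Proof.
move=> p q /eqP; rewrite /= tofrac_eq => /eqP.
exact: ps_of_mpoly_inj.
Qed.

HB.instance Definition _ := GRing.isZmodMorphism.Build _ _ ratfrac_incl
  (frac_ext_zmod tofrac_ps_of_mpoly_inj).
HB.instance Definition _ := GRing.isMonoidMorphism.Build _ _ ratfrac_incl
  (frac_ext_monoid tofrac_ps_of_mpoly_inj).

Lemma ratfrac_incl_tofrac (p : {mpoly k[n]}) :
  ratfrac_incl (FracField.tofrac p) = FracField.tofrac (ps_of_mpoly p).
Proof. exact: (frac_ext_tofrac tofrac_ps_of_mpoly_inj). Qed.

End Expansion.

(* Main.v *)
(* Put q = sum_j r_j x^(h_j). The recurrence says that q s is supported on A, so
   s is a quotient of polynomials. At a lex-minimal exponent g of the support of
   s outside N^n, the recurrence writes r_0 s_g in terms of coefficients of s at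
   the smaller exponents g - h_j, which are outside N^n as well; hence there is
   no such g, and s is a power series. *)

Require Import Defs.
From HB Require Import structures.
From mathcomp Require Import all_boot all_order all_algebra.
From mathcomp Require Import boolp classical_sets functions cardinality fsbigop.
From mathcomp Require Import mpoly.

Set Implicit Arguments.
Unset Strict Implicit.
Unset Printing Implicit Defensive.

Import Order.TTheory GRing.Theory Num.Theory.
Local Open Scope ring_scope.
Local Open Scope classical_set_scope.

(** Lets identities in $k((\underline{x}))$ be checked on expansions in $k((\mathbb{Z}^n))$. *)
Lemma expand_inj (k : fieldType) (n : nat) : injective (@expand k n).
Proof. exact: fmorph_inj. Qed.

Lemma hahn_sumE (k : fieldType) (n : nat) (I : Type) (r : seq I)
    (F : I -> hahn k n) (g : Zlex n) :
  (\sum_(i <- r) F i) g = \sum_(i <- r) F i g.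
Proof.
by apply: (big_morph (fun x : hahn k n => x g)) => [x y|];
  rewrite ?hahnDE ?hahn0E.
Qed.

Lemma hahn_of_ps_monomial (k : fieldType) (n : nat) (c : k) (m : 'X_{1..n}) :
  hahn_of_ps (ps_of_mpoly (c *: 'X_[m])) = hahn_mon c (mnm_lex m).
Proof.
apply: hahn_ps_ext => [u|g] /=.
  rewrite (inj_eq (can_inj (@mnm_lexK n))) mcoeffZ mcoeffX eq_sym.
  by case: eqP => _; rewrite ?mulr1 ?mulr0.
by case: (g =P _) => [->|_]; rewrite ?eqxx // => _; apply: mnm_lex_nonneg.
Qed.

(** Nonnegativity matters because [lex_mnm] takes absolute values of the exponents. *)
Lemma hahn_of_ps_sum_monomials (k : fieldType) (n l : nat)
    (h : 'I_l -> Zlex n) (c : 'I_l -> k) (h_nonneg : forall j, lex_nonneg (h j)) :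
  hahn_of_ps (ps_of_mpoly (\sum_j c j *: 'X_[lex_mnm (h j)])) =
  \sum_j hahn_mon (c j) (h j).
Proof.
rewrite !raddf_sum /=; apply: eq_bigr => j _.
by rewrite hahn_of_ps_monomial lex_mnmK.
Qed.

Lemma hahn_sum_monomials_at (k : fieldType) (n l : nat)
    (h : 'I_l -> Zlex n) (c : 'I_l -> k) (j : 'I_l) :
  injective h -> (\sum_i hahn_mon (c i) (h i)) (h j) = c j.
Proof.
move=> h_inj; rewrite hahn_sumE (bigD1 j) //= eqxx big1 ?addr0 // => i ij.
by rewrite (inj_eq h_inj) eq_sym (negPf ij).
Qed.

(** Stated in $k((\mathbb{Z}^n))$, where the well-ordered support supplies a least bad exponent. *)
Lemma recurrence_nonneg_support (k : fieldType) (n l : nat) (s : hahn k n)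
    (h : 'I_l.+1 -> Zlex n) (r : 'I_l.+1 -> k)
    (h0 : h ord0 = 0) (r0 : r ord0 != 0) (h_nonneg : forall j, lex_nonneg (h j))
    (h_gt0 : forall j, j != ord0 -> (0 < h j :> Zlex n)%O)
    (recurrence : forall g, g \notin codom h ->
      \sum_j r j * s (g - h j) = 0) (g : Zlex n) :
  s g != 0 -> lex_nonneg g.
Proof.
move=> sg; apply: contrapT => /negP gN.
have [||m [sm mN] mP] :=
    @hahn_wo k n s [set x | s x != 0 /\ ~~ lex_nonneg x].
- by move=> x [].
- by exists g.
move/eqP: sm; apply; apply: (mulfI r0); rewrite mulr0.
have mA : m \notin codom h by apply: contraNN mN => /codomP [j ->].
rewrite -[RHS](recurrence m mA) (bigD1 ord0) //= h0 subr0 big1 ?addr0 // => j j0.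
apply/eqP; rewrite mulf_eq0; apply/orP; right.
apply: contrapT => /negP smj.
(* If [m - h j] were in $\mathbb{N}^n$, adding [h j] back would put [m] there. So it is a bad
   exponent too, and minimality of [m] contradicts [0 < h j]. *)
have : (m <= m - h j)%O.
  apply: mP; split=> //; apply: contraNN mN => mjN.
  by rewrite -(subrK (h j) m); apply: lex_nonnegD.
by rewrite -{1}[m]subr0 lex_leB2l leNgt h_gt0.
Qed.

Theorem corollary7p7 (k : fieldType) (n : nat) (n_gt0 : (0 < n)%N)
  (s : {fraction (pseries k n)})
  (l : nat) (h : 'I_l.+1 -> Zlex n) (r : 'I_l.+1 -> k)
  (h0 : h ord0 = 0) (r0 : r ord0 != 0)
  (h_nonneg : forall (j : 'I_l.+1) (i : 'I_n), 0 <= h j i)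
  (h_lt : forall i j : 'I_l.+1, (i < j)%N -> (h i < h j)%O)
  (recurrence : forall g : Zlex n, g \notin codom h ->
    \sum_(j < l.+1) r j * expand s (g - h j) = 0) :
  (range (@ratfrac_incl k n) `&` range (@FracField.tofrac (pseries k n))) s.
Proof.
have hN j : lex_nonneg (h j) by apply/forallP.
have h_inj : injective h.
  move=> i j hij; apply: val_inj => /=; case: (ltngtP i j) => // /h_lt;
  by rewrite hij ltxx.
split.
  (* [c j] is the coefficient of $qs$ at [h j], so [p] is the candidate for $qs$. *)
  pose c j := \sum_(i < l.+1) r i * expand s (h j - h i).
  pose q : {mpoly k[n]} := \sum_j r j *: 'X_[lex_mnm (h j)].
  pose p : {mpoly k[n]} := \sum_j c j *: 'X_[lex_mnm (h j)].
  have qE := hahn_of_ps_sum_monomials r hN; rewrite -/q in qE.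
  have pE := hahn_of_ps_sum_monomials c hN; rewrite -/p in pE.
  (* The coefficient of [q] at [h ord0] is [r ord0]. *)
  have q0 : q != 0.
    apply: contraNneq r0 => q0; rewrite -(hahn_sum_monomials_at r ord0 h_inj).
    by rewrite -qE q0 !rmorph0 hahn0E.
  have qs : hahn_of_ps (ps_of_mpoly q) * expand s = hahn_of_ps (ps_of_mpoly p).
    apply/hahnP => g; rewrite qE pE mulr_suml [LHS]hahn_sumE.
    under eq_bigr do rewrite hahn_monE.
    (* On $A$ both sides are [c j]; off $A$ the left side vanishes by the recurrence and the right
       side has no monomial. *)
    have [/codomP [j ->]|gA] := boolP (g \in codom h).
      by rewrite (hahn_sum_monomials_at c j h_inj).
    rewrite recurrence // hahn_sumE big1 // => j _ /=.
    by case: eqP gA => // ->; rewrite codom_f.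
  exists (FracField.tofrac p / FracField.tofrac q) => //.
  rewrite fmorph_div /= !ratfrac_incl_tofrac.
  have q0' : FracField.tofrac (ps_of_mpoly q) != 0.
    by rewrite tofrac_eq0 -(rmorph0 (@ps_of_mpoly k n)) (inj_eq (@ps_of_mpoly_inj k n)).
  apply: (mulIf q0'); rewrite divfK //; apply: expand_inj.
  by rewrite rmorphM /= !expand_tofrac mulrC qs.
(* Restricting the expansion to $\mathbb{N}^n$ loses nothing once its support is known to lie
   there. *)
exists (PSeries (fun m => expand s (mnm_lex m))) => //.
apply: expand_inj; rewrite expand_tofrac; apply: hahn_ps_ext => //.
apply: (recurrence_nonneg_support h0 r0 hN) recurrence => j j0.
by rewrite -h0; apply: h_lt; rewrite lt0n.
Qed.
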